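(* Assume (A1)–(A4) and $(RC_+)$, and let $\pi^+_t:=\mathbf{1}_{R^+}(X_{t-1})$. Then there is $\alpha_0<0$ such that for every $\alpha\in(\alpha_0,0)$, with $U(x):=-x^\alpha$ on $(0,\infty)$, there are constants $K=K(\alpha)>0$ and $c=c(\alpha)>0$ with $$|\mathbb{E}U(V_t^{\pi^+})|\le Ke^{-ct}\quad\text{for all sufficiently large }t.$$
   Context: Setting: $\mu,\sigma:\mathbb{R}\to\mathbb{R}$ measurable, $(\varepsilon_t)_{t\ge1}$ i.i.d., $X_0\in\mathbb{R}$ constant, $X_t=X_{t-1}+\mu(X_{t-1})+\sigma(X_{t-1})\varepsilon_t$, $S_t=e^{X_t}$, $\mathcal{F}_t=\sigma(X_s,s\le t)$. Wealth of a predictable $[0,1]$-valued strategy $\pi_t$: $V_0^\pi=V_0>0$, $V_t^\pi=V_{t-1}^\pi((1-\pi_t)+\pi_tS_t/S_{t-1})$. (A1) $\varepsilon_1$ has a density w.r.t. Lebesgue measure $\lambda$, bounded and bounded away from $0$ on compacts; (A2) $\mu$ locally bounded, $\sigma$ positive, bounded away from $0$ on compacts, globally bounded; (A3) $\limsup_{|x|\to\infty}|x+\mu(x)|/|x|<1$; (A4) $\mathbb{E}e^{\kappa\varepsilon_1^2}<\infty$ for some $\kappa>0$, $\mathbb{E}\varepsilon_1=0$. $(RC_+)$: $R^+:=\{x:\mu(x)>0\}$ has $\lambda(R^+)>0$. *)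

(* Defs.v *)
From HB Require Import structures.
From mathcomp Require Import all_boot all_order all_algebra.
From mathcomp Require Import all_classical all_reals all_analysis.
Set Implicit Arguments. Unset Strict Implicit. Unset Printing Implicit Defensive.
Import Order.TTheory GRing.Theory Num.Theory.
Import numFieldNormedType.Exports.
Local Open Scope classical_set_scope.
Local Open Scope ring_scope.

Section Defs.
Context {d : measure_display} {T : measurableType d} {R : realType}.

Definition mutually_independent (P : probability T R) (eps : nat -> T -> R)
    (I : set nat) : Prop :=
  forall (J : seq nat) (A : nat -> set R), uniq J ->
    (forall i, i \in J -> I i) -> (forall i, measurable (A i)) ->
    P (\bigcap_(i in [set` J]) (eps i @^-1` A i)) =
    (\prod_(i <- J) P (eps i @^-1` A i))%E.

Fixpoint Xproc (mu sigma : R -> R) (eps : nat -> T -> R) (X0 : R)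
    (t : nat) (w : T) : R :=
  match t with
  | 0 => X0
  | t'.+1 => let x := Xproc mu sigma eps X0 t' w in
             x + mu x + sigma x * eps t'.+1 w
  end.

Definition Sproc (mu sigma : R -> R) (eps : nat -> T -> R) (X0 : R)
    (t : nat) (w : T) : R := expR (Xproc mu sigma eps X0 t w).

Fixpoint wealth (V0 : R) (pi : nat -> T -> R) (S : nat -> T -> R)
    (t : nat) (w : T) : R :=
  match t with
  | 0 => V0
  | t'.+1 => wealth V0 pi S t' w *
             ((1 - pi t'.+1 w) + pi t'.+1 w * S t'.+1 w / S t' w)
  end.

Definition pi_plus (mu sigma : R -> R) (eps : nat -> T -> R) (X0 : R)
    (t : nat) (w : T) : R :=
  \1_[set x : R | 0 < mu x] (Xproc mu sigma eps X0 t.-1 w).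

End Defs.

(* Main.v *)
(** The logarithm of the wealth gains 1_{R+}(x) (mu(x) + sigma(x) eps) when the
    chain jumps from x, so that E V_t^(-a) is controlled by a multiplicative
    drift condition.  Let A be a bounded set of positive measure on which
    mu > eta > 0, and w(x) = beta (|x| - D 1_A(x)).  Off a large ball |x|
    decreases in mean by (A3); inside the ball but off A, the term -D 1_A wins,
    because by (A1) the chain enters A in one step with probability bounded
    below; on A a small beta makes the loss smaller than the expected gain eta.
    Hence w(X_1) - w(x) - 1_{R+}(x) (X_1 - x) has mean at most -delta, uniformly
    in x, after replacing it by an upper bound Z with |Z| <= C (1 + |eps|).
    By (A4), E exp (a Z) <= 1 - a delta + O(a^2), which is at most
    exp (- a delta / 2) for small a, so
    E exp (a (w(X_t) - log (V_t / V_0))) decays geometrically; w is bounded below. *)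
Require Import Defs.
From HB Require Import structures.
From mathcomp Require Import all_boot all_order all_algebra.
From mathcomp Require Import all_classical all_reals all_analysis.
From mathcomp Require Import measurable_realfun ring lra.
Set Implicit Arguments.
Unset Strict Implicit.
Unset Printing Implicit Defensive.
Import Order.TTheory GRing.Theory Num.Theory.
Import numFieldNormedType.Exports.
Local Open Scope classical_set_scope.
Local Open Scope ring_scope.

(** * Affine images of Lebesgue measure and integrals over independent pairs *)

(** The pushforward of Lebesgue measure under [c + s * e], scaled by [s], gives each interval []a,
    b]] its length, so uniqueness of Lebesgue measure applies. *)
Lemma lebesgue_measure_affine (R : realType) (c s : R) (A : set R) :
  0 < s -> measurable A ->
  lebesgue_measure A =
  (s%:E * lebesgue_measure ((fun e => (c + s * e)%R) @^-1` A))%E.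
Proof.
move=> s0 mA.
have mf : measurable_fun [set: measurableTypeR R]
    ((fun e => c + s * e) : measurableTypeR R -> measurableTypeR R).
  by apply: measurable_funD => //; exact: measurable_funM.
pose f : {mfun measurableTypeR R >-> measurableTypeR R} :=
  @mfun_Sub _ _ (measurableTypeR R) (measurableTypeR R) _ (mem_set mf).
have -> : (s%:E * lebesgue_measure ((fun e => (c + s * e)%R) @^-1` A))%E =
    mscale (NngNum (ltW s0)) (pushforward (@lebesgue_measure R) f) A by [].
apply: lebesgue_measure_unique => // _ [[a b]] _ <-.
rewrite /mscale /pushforward /=.
rewrite [X in _ = (_ * lebesgue_measure X)%E](_ : _ =
    `](a - c) / s, (b - c) / s]%classic); last first.
  apply/seteqP; split=> x /=; rewrite !in_itv/= ltr_pdivrMr// ler_pdivlMr// mulrC;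
    by rewrite ltrBlDl lerBrDl.
rewrite !lebesgue_measure_itv/= !lte_fin ltr_pM2r ?invr_gt0// ltrBlDr subrK.
case: ifP => ab; last by rewrite mule0.
rewrite -!EFinD -EFinM; congr EFin.
by field; rewrite gt_eqF.
Qed.

(** Factorisation on rectangles forces the joint law to be the product of the marginal laws; Tonelli
    then splits the integral, and each marginal integral is pulled back to [P]. *)
Lemma integral_indep_pair (d d1 d2 : measure_display) (T : measurableType d)
  (E1 : measurableType d1) (E2 : measurableType d2) (R : realType)
  (P : probability T R) (X : {mfun T >-> E1}) (Z : {mfun T >-> E2})
  (F : E1 * E2 -> \bar R) :
  measurable_fun setT F -> (forall z, 0 <= F z)%E ->
  (forall A B, measurable A -> measurable B ->
    P (X @^-1` A `&` Z @^-1` B) = P (X @^-1` A) * P (Z @^-1` B))%E ->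
  (\int[P]_w F (X w, Z w) = \int[P]_w \int[P]_v F (X w, Z v))%E.
Proof.
move=> mF F0 XZ.
have mXZ : measurable_fun setT (fun w => (X w, Z w)).
  exact: measurable_fun_pair.
pose XZf : {mfun T >-> (E1 * E2)%type} := mfun_Sub (mem_set mXZ).
have -> : (\int[P]_w F (X w, Z w) = \int[distribution P XZf]_z F z)%E.
  by rewrite ge0_integral_distribution.
have -> : (\int[distribution P XZf]_z F z =
    \int[distribution P X \x distribution P Z]_z F z)%E.
  apply: eq_measure_integral => A mA _.
  apply/esym; apply: (@product_measure_unique _ _ _ _ _ (distribution P X)
    (distribution P Z) (distribution P XZf)) => //.
rewrite fubini_tonelli1// ge0_integral_distribution//; last 2 first.
- exact: measurable_fun_fubini_tonelli_F.
- by move=> x; apply: integral_ge0.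
apply: eq_integral => w _ /=.
rewrite /fubini_F ge0_integral_distribution//.
exact: measurable_fun_pair2.
Qed.

(** * Independence of the next noise from the past, and equality in law *)

(** A pi-system generating the sigma-algebra of [eps 1], ..., [eps t]. Finite rectangles are the
    sets that [mutually_independent] speaks of; index 0 is left out because the noise starts at time
    1. *)
Definition past_rect (d : measure_display) (T : measurableType d) (R : realType)
    (eps : nat -> T -> R) (t : nat) : set (set T) :=
  [set E | exists2 A : nat -> set R, (forall i, measurable (A i)) &
    E = \bigcap_(i in [set` iota 1 t]) eps i @^-1` A i].

Lemma setI_closed_past_rect (d : measure_display) (T : measurableType d)
  (R : realType) (eps : nat -> T -> R) (t : nat) :
  setI_closed (past_rect eps t).
Proof.
move=> _ _ [A mA ->] [B mB ->]; exists (fun i => A i `&` B i).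
  by move=> i; exact: measurableI.
by rewrite -bigcapI.
Qed.

(** For fixed [B] both sides are finite measures in [E]. They agree on the intersection-stable class
    [past_rect], hence on the sigma-algebra it generates. *)
Lemma past_indep (d : measure_display) (T : measurableType d) (R : realType)
  (P : probability T R) (eps : nat -> T -> R) (t : nat) (E : set T) (B : set R) :
  (forall i, measurable_fun setT (eps i)) ->
  mutually_independent P eps [set i | (0 < i)%N] ->
  <<s past_rect eps t >> E -> measurable B ->
  (P (E `&` eps t.+1 @^-1` B) = P E * P (eps t.+1 @^-1` B))%E.
Proof.
move=> meps ind sE mB.
have mX i C : measurable C -> measurable (eps i @^-1` C).
  by move=> mC; rewrite -[X in measurable X]setTI; exact: meps.
pose C := eps t.+1 @^-1` B.
have mC : measurable C by exact: mX.
have PC0 : 0 <= fine (P C) by apply: fine_ge0.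
have PCE : ((fine (P C))%:E = P C)%E by rewrite fineK ?fin_num_measure.
have -> : P (E `&` C) = mrestr P mC E by [].
have -> : (P E * P C)%E = mscale (NngNum PC0) P E.
  by rewrite /mscale/= PCE muleC.
apply: (g_sigma_algebra_measure_unique (past_rect eps t) _ (fun=> setT)) => //.
- move=> _ [A mA ->]; apply: fin_bigcap_measurable; first exact: finite_seq.
  by move=> i _; exact: mX.
- by move=> _; exists (fun=> setT) => //; apply/esym/seteqP; split.
- by apply/seteqP; split => // x _; exists 0%N.
- exact: setI_closed_past_rect.
- move=> _ [A mA ->]; rewrite /= /mrestr /mscale/= PCE.
  have iotaE : iota 1 t.+1 = iota 1 t ++ [:: t.+1] by rewrite -(addn1 t) iotaD addn1.
  (* With [B] as side number [t.+1], the intersection becomes a rectangle over the indices 1 to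
     [t.+1], so [ind] factors it. *)
  pose A' i := if i == t.+1 then B else A i.
  have mA' i : measurable (A' i) by rewrite /A'; case: ifP.
  have AA' i : i \in iota 1 t -> A i = A' i.
    by rewrite mem_iota add1n /A' => /andP[_]; case: eqP => // ->; rewrite ltnn.
  have -> : \bigcap_(i in [set` iota 1 t]) eps i @^-1` A i =
            \bigcap_(i in [set` iota 1 t]) eps i @^-1` A' i.
    by apply: eq_bigcapr => i /= /AA' ->.
  have -> : C = eps t.+1 @^-1` A' t.+1 by rewrite /A' eqxx.
  have -> : \bigcap_(i in [set` iota 1 t]) eps i @^-1` A' i `&`
      eps t.+1 @^-1` A' t.+1 =
      \bigcap_(i in [set` iota 1 t.+1]) eps i @^-1` A' i.
    by rewrite !bigcap_seq iotaE big_cat big_seq1.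
  have pos n i : i \in iota 1 n -> (0 < i)%N by rewrite mem_iota => /andP[].
  rewrite !ind ?iota_uniq//; try exact: pos.
  by rewrite iotaE big_cat big_seq1/= muleC.
- by move=> _; rewrite /= /mrestr setTI -ge0_fin_numE// fin_num_measure.
Qed.

Lemma measurable_past (d : measure_display) (T : measurableType d)
  (R : realType) (eps : nat -> T -> R) (t i : nat) : i \in iota 1 t ->
  @measurable_fun _ _ (g_sigma_algebraType (past_rect eps t)) R setT (eps i).
Proof.
move=> it _ B mB; rewrite setTI; apply: sub_sigma_algebra.
exists (fun j => if j == i then B else setT); first by move=> j; case: ifP.
apply/seteqP; split=> [w Bw j _ /=|w /(_ i it) /=]; last by rewrite eqxx.
by case: eqP => // ->.
Qed.

Lemma ge0_integral_eq_law (d d' : measure_display) (T : measurableType d)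
  (E : measurableType d') (R : realType) (P : probability T R) (X Y : T -> E)
  (g : E -> \bar R) :
  measurable_fun setT X -> measurable_fun setT Y -> measurable_fun setT g ->
  (forall x, 0 <= g x)%E ->
  (forall B, measurable B -> P (X @^-1` B) = P (Y @^-1` B)) ->
  (\int[P]_w g (X w) = \int[P]_w g (Y w))%E.
Proof.
move=> mX mY mg g0 XY.
pose X' : {mfun T >-> E} := mfun_Sub (mem_set mX).
pose Y' : {mfun T >-> E} := mfun_Sub (mem_set mY).
have iE (Z : {mfun T >-> E}) :
    (\int[P]_w g (Z w) = \int[distribution P Z]_x g x)%E.
  by rewrite ge0_integral_distribution.
rewrite (iE X') (iE Y').
by apply: eq_measure_integral => B mB _; exact: XY.
Qed.

(** * Chains driven by independent noise and their geometric drift *)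

Section chain.
Context {d dE : measure_display} {T : measurableType d} {E : measurableType dE}
  {R : realType}.

Fixpoint chain (phi : E * R -> E) (y0 : E) (eps : nat -> T -> R) (t : nat)
    (w : T) : E :=
  if t is t'.+1 then phi (chain phi y0 eps t' w, eps t w) else y0.

(** [T] is arbitrary and only the first [t] noises are assumed measurable, so the lemma also applies
    to [T] with the sigma-algebra of the past, where it says that the chain is adapted. *)
Lemma measurable_chain (phi : E * R -> E) (y0 : E) (eps : nat -> T -> R)
  (t : nat) : measurable_fun setT phi ->
  (forall i, i \in iota 1 t -> measurable_fun setT (eps i)) ->
  measurable_fun setT (chain phi y0 eps t).
Proof.
move=> mphi; elim: t => [|t IH] meps /=; first exact: measurable_cst.
apply: (measurableT_comp mphi); apply: measurable_fun_pair.
  by apply: IH => i; rewrite mem_iota => /andP[i0 it]; apply: meps;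
    rewrite mem_iota i0 /= (ltn_trans it).
by apply: meps; rewrite mem_iota/= add1n.
Qed.

End chain.

(** By induction on [t]: the noise [eps t.+1] is independent of the state at time [t] and has the
    law of [eps 1], so integrating it out first gains one factor [rho]. *)
Lemma chain_drift (d dE : measure_display) (T : measurableType d)
  (E : measurableType dE) (R : realType) (P : probability T R)
  (eps : nat -> T -> R) (phi : E * R -> E) (y0 : E) (W : E -> R) (rho : R)
  (t : nat) :
  (forall i, measurable_fun setT (eps i)) ->
  mutually_independent P eps [set i | (0 < i)%N] ->
  (forall i, (0 < i)%N -> forall B : set R, measurable B ->
     P (eps i @^-1` B) = P (eps 1%N @^-1` B)) ->
  measurable_fun setT phi -> measurable_fun setT W ->
  (forall y, 0 <= W y) -> 0 <= rho ->
  (forall y, \int[P]_v (W (phi (y, eps 1%N v)))%:E <= (rho * W y)%:E)%E ->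
  (\int[P]_w (W (chain phi y0 eps t w))%:E <= (rho ^+ t * W y0)%:E)%E.
Proof.
move=> meps ind idd mphi mW W0 rho0 drift.
have mchain s : measurable_fun setT (chain phi y0 eps s).
  by apply: measurable_chain.
elim: t => [|t IH] /=.
  by rewrite integral_cst// [X in (_ * X)%E]probability_setT mule1 expr0 mul1r.
have mF : measurable_fun setT (fun z : E * R => (W (phi z))%:E).
  by apply/measurable_EFinP; exact: measurableT_comp.
pose X : {mfun T >-> E} := mfun_Sub (mem_set (mchain t)).
pose Z : {mfun T >-> R} := mfun_Sub (mem_set (meps t.+1)).
have indXZ A B : measurable A -> measurable B ->
    (P (X @^-1` A `&` Z @^-1` B) = P (X @^-1` A) * P (Z @^-1` B))%E.
  move=> mA mB; apply: past_indep => //; rewrite -[X @^-1` A]setTI.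
  (* The state at time [t] is a function of [eps 1], ..., [eps t], so its events lie in the
     sigma-algebra of the past. *)
  apply: (@measurable_chain _ _ (g_sigma_algebraType (past_rect eps t))) => //.
  by move=> i; exact: measurable_past.
have F0 z : (0 <= (W (phi z))%:E)%E by rewrite lee_fin.
rewrite (integral_indep_pair mF F0 indXZ).
have mWchain : measurable_fun setT (fun w => (W (chain phi y0 eps t w))%:E).
  by apply/measurable_EFinP; exact: measurableT_comp.
apply: (@le_trans _ _ (\int[P]_w (rho%:E * (W (chain phi y0 eps t w))%:E))%E).
  apply: ge0_le_integral => //.
  - by move=> w _; apply: integral_ge0.
  (* The inner integral is a partial integral against the law of [eps t.+1], evaluated at [X w];
     Tonelli makes it measurable. *)
  - have mFF := measurable_fun_fubini_tonelli_F (m2 := distribution P Z) _ mF F0.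
    rewrite [X in measurable_fun _ X](_ : _ = (fubini_F (distribution P Z)
        (fun z => (W (phi z))%:E)) \o X); first exact: measurableT_comp.
    apply/funext => w; rewrite /fubini_F /= ge0_integral_distribution//.
    exact: (measurable_fun_pair2 (X w) mF).
  - exact: emeasurable_funM.
  - move=> w _; rewrite -EFinM; apply: le_trans (drift _).
    by rewrite (ge0_integral_eq_law (meps t.+1) (meps 1%N)
      (measurable_fun_pair2 (X w) mF) (fun x => F0 (X w, x)) (idd t.+1 isT)).
rewrite ge0_integralZl//; last by move=> w _; rewrite lee_fin.
by rewrite exprS -mulrA EFinM lee_wpmul2l.
Qed.

(** * Exponential inequalities and exponential moments *)

(** Both signs start from [expR u <= 1 + u * expR u], which is [1 - u <= expR (- u)] rearranged. The
    term [u * expR u] is then bounded by the same inequality times [u] if [u >= 0], and by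
    [1 + u <= expR u] times [u] if [u < 0]. *)
Lemma expR_le_quad (R : realType) (u : R) :
  expR u <= 1 + u + u ^+ 2 * expR `|u|.
Proof.
have subinv (v : R) : expR v * (1 - v) <= 1.
  have := expR_ge1Dx (- v); rewrite expRN => h.
  by rewrite mulrC -ler_pdivlMr ?expR_gt0// mul1r.
have h1 := subinv u; have [u0|u0] := leP 0 u.
  rewrite ger0_norm//.
  have h2 : u * (expR u * (1 - u)) <= u * 1 by rewrite ler_wpM2l.
  by rewrite expr2; lra.
have h2 : 1 + u <= expR u by exact: expR_ge1Dx.
have h3 : 1 <= expR `|u| by rewrite -expR0 ler_expR.
have h4 : u ^+ 2 * 1 <= u ^+ 2 * expR `|u| by rewrite ler_wpM2l ?sqr_ge0.
have h5 : u * (1 + u) >= u * expR u by rewrite ler_wnM2l// ltW.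
by rewrite expr2 in h4 *; lra.
Qed.

(** Separates [a] from [z] in the remainder. The factor 3 collects one [expR |z|] from the
    exponential and two from [z ^+ 2 <= expR |z| ^+ 2]. *)
Lemma expRM_le_quad (R : realType) (a z : R) : 0 <= a <= 1 ->
  expR (a * z) <= 1 + a * z + a ^+ 2 * expR (3 * `|z|).
Proof.
move=> /andP[a0 a1]; apply: le_trans (expR_le_quad _) _; rewrite lerD2l.
have h1 : expR `|a * z| <= expR `|z|.
  by rewrite ler_expR normrM (ger0_norm a0) ler_piMl.
have h2 : z ^+ 2 <= expR `|z| ^+ 2.
  rewrite -(real_normK (num_real z)) lerXn2r ?nnegrE ?expR_ge0//.
  by apply: le_trans (expR_ge1Dx _); rewrite lerDr.
have -> : expR (3 * `|z|) = expR `|z| ^+ 2 * expR `|z|.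
  by rewrite expr2 -!expRD; congr expR; ring.
rewrite exprMn -mulrA ler_wpM2l ?sqr_ge0//.
by apply: ler_pM; rewrite ?sqr_ge0 ?expR_ge0.
Qed.

(** The mean of [expR (a * Z)] is at most [1 - a * delta + a ^+ 2 * M], and the smallness of [a * M]
    reduces this to [1 - a * delta / 2]. Domination by [expR (3 * g)] provides every
    integrability. *)
Lemma exp_moment_drift (d : measure_display) (T : measurableType d)
  (R : realType) (P : probability T R) (Z g : T -> R) (delta M a : R) :
  measurable_fun setT Z -> (forall w, `|Z w| <= g w) ->
  P.-integrable setT (fun w => (expR (3 * g w))%:E) ->
  (\int[P]_w (expR (3 * g w))%:E <= M%:E)%E ->
  (\int[P]_w (Z w)%:E <= (- delta)%:E)%E ->
  0 <= a <= 1 -> a * M <= delta / 2 ->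
  (\int[P]_w (expR (a * Z w))%:E <= (expR (- (a * delta / 2)))%:E)%E.
Proof.
move=> mZ Zg iG GM Zd /andP[a0 a1] aM.
have gl w : expR `|Z w| <= expR (3 * g w).
  rewrite ler_expR; have := Zg w; have := normr_ge0 (Z w); lra.
have iZ : P.-integrable setT (fun w => (Z w)%:E).
  apply: le_integrable iG => //; first exact/measurable_EFinP.
  move=> w _ /=; rewrite lee_fin (ger0_norm (expR_ge0 _)).
  apply: le_trans (gl w); apply: le_trans (expR_ge1Dx _).
  by rewrite lerDr.
have mexp : measurable_fun setT (fun w => expR (a * Z w)).
  by apply: measurableT_comp => //; exact: measurable_funM.
have iE : P.-integrable setT (fun w => (expR (a * Z w))%:E).
  apply: le_integrable iG => //; first exact/measurable_EFinP.
  move=> w _ /=; rewrite lee_fin !(ger0_norm (expR_ge0 _)).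
  apply: le_trans (gl w); rewrite ler_expR.
  by apply: le_trans (ler_norm _) _; rewrite normrM (ger0_norm a0) ler_piMl.
have i1 : P.-integrable setT (fun=> (1 : R)%:E).
  exact: finite_measure_integrable_cst.
have iaZ := integrableZl measurableT a iZ.
have iaG := integrableZl measurableT (a ^+ 2) iG.
have i1Z := integrableD measurableT i1 iaZ.
have i1ZG := integrableD measurableT i1Z iaG.
have E1 : (\int[P]_w (expR (a * Z w))%:E <= \int[P]_w
    ((1%:E + a%:E * (Z w)%:E) + (a ^+ 2)%:E * (expR (3 * g w))%:E))%E.
  apply: le_integral => // w _; rewrite -!EFinM -!EFinD lee_fin.
  apply: le_trans (expRM_le_quad _ _) _; first by rewrite a0.
  by rewrite lerD2l ler_wpM2l ?sqr_ge0// ler_expR ler_pM2l.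
apply: (le_trans E1).
rewrite integralD// integralD// !integralZl// integral_cst//.
rewrite [X in (_ * X)%E]probability_setT mule1.
apply: (@le_trans _ _ (1%:E + a%:E * (- delta)%:E + (a ^+ 2)%:E * M%:E)%E).
  apply: leeD; last by rewrite lee_wpmul2l// lee_fin sqr_ge0.
  by apply: leeD => //; rewrite lee_wpmul2l.
rewrite -!EFinM -!EFinD lee_fin; apply: le_trans (expR_ge1Dx _).
have := ler_wpM2l a0 aM; rewrite expr2; lra.
Qed.

(** Completing the square gives [c * |e| <= kappa * e ^+ 2 + c ^+ 2 / (4 * kappa)], so a multiple of
    the Gaussian-type moment dominates. *)
Lemma integrable_expR_linear (d : measure_display) (T : measurableType d)
  (R : realType) (P : probability T R) (e : T -> R) (kappa b c : R) :
  measurable_fun setT e -> 0 < kappa ->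
  (\int[P]_w (expR (kappa * e w ^+ 2))%:E < +oo)%E ->
  P.-integrable setT (fun w => (expR (b + c * `|e w|))%:E).
Proof.
move=> me k0 koo.
have mke : measurable_fun setT (fun w => expR (kappa * e w ^+ 2)).
  apply: measurableT_comp => //; apply: measurable_funM => //.
  exact: measurable_funX.
have ike : P.-integrable setT (fun w => (expR (kappa * e w ^+ 2))%:E).
  apply/integrableP; split; first exact/measurable_EFinP.
  by under eq_integral => w _ do rewrite abse_EFin (ger0_norm (expR_ge0 _)).
have ikeZ := integrableZl measurableT (expR (b + c ^+ 2 / (4 * kappa))) ike.
apply: le_integrable ikeZ => //.
  apply/measurable_EFinP; apply: measurableT_comp => //.
  apply: measurable_funD => //; apply: measurable_funM => //.
  exact: measurableT_comp.
move=> w _ /=; rewrite lee_fin (ger0_norm (expR_ge0 _)).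
rewrite (ger0_norm (mulr_ge0 (expR_ge0 _) (expR_ge0 _))) -expRD.
rewrite ler_expR -addrA lerD2l -(real_normK (num_real (e w))).
have -> : c ^+ 2 / (4 * kappa) + kappa * `|e w| ^+ 2 =
    c * `|e w| + kappa * (`|e w| - c / (2 * kappa)) ^+ 2.
  by field; rewrite gt_eqF.
by rewrite lerDl mulr_ge0 ?sqr_ge0// ltW.
Qed.

(** * A bounded set of favourable drift, and the chance of entering it in one step *)

(** These sets cover [mu > 0]; if all were null, their countable union would be null too. *)
Lemma bounded_sublevel_gt0 (R : realType) (mu : R -> R) :
  measurable_fun setT mu ->
  (0 < lebesgue_measure [set x : R | (0 < mu x)%R])%E ->
  exists2 n : nat, (0 < n)%N & (0 < lebesgue_measure
    [set x : R | (n%:R^-1 < mu x)%R /\ (`|x| <= n%:R)%R])%E.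
Proof.
move=> mmu.
pose A (n : nat) := [set x : R | (n.+1%:R^-1 < mu x)%R /\ (`|x| <= n.+1%:R)%R].
have mA n : measurable (A n).
  rewrite [X in measurable X](_ : _ =
      mu @^-1` `]n.+1%:R^-1, +oo[ `&` Num.norm @^-1` `]-oo, n.+1%:R]).
    by apply: measurableI; rewrite -[X in measurable X]setTI;
      [exact: mmu|exact: normr_measurable].
  by apply/seteqP; split=> x /=; rewrite !in_itv/= ?andbT.
apply: contraPP => noA; apply/negP; rewrite -leNgt le_eqVlt; apply/orP; left.
have mpos : measurable [set x | 0 < mu x].
  rewrite -[X in measurable X]setTI.
  have -> : [set x | 0 < mu x] = mu @^-1` `]0, +oo[%classic.
    by apply/seteqP; split=> x /=; rewrite in_itv/= andbT.
  exact: mmu.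
apply/eqP/(negligibleP lebesgue_measure mpos).
apply: (@negligibleS _ (measurableTypeR R) R lebesgue_measure (\bigcup_n A n)).
  move=> x /= mx0.
  pose n := maxn (Num.truncn (mu x)^-1) (Num.truncn `|x|).
  exists n => //; split.
    rewrite invf_plt ?posrE//; apply: lt_le_trans (truncnS_gt _) _.
    by rewrite ler_nat ltnS leq_maxl.
  apply/ltW; apply: lt_le_trans (truncnS_gt _) _.
  by rewrite ler_nat ltnS leq_maxr.
apply: negligible_bigcup => n; apply/(negligibleP lebesgue_measure (mA n)).
apply/eqP; rewrite eq_le measure_ge0 andbT leNgt; apply/negP => An.
by apply: noA; exists n.+1.
Qed.

(** The noise values that send [x] into [A] form a set of Lebesgue measure
    [|A| / sigma x >= |A| / M], contained in a fixed ball on which the density is bounded below. *)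
Lemma affine_hitting_gt0 (d : measure_display) (T : measurableType d)
  (R : realType) (P : probability T R) (e : T -> R) (f mu sigma : R -> R)
  (A : set R) (r Mmu m M : R) :
  measurable_fun setT e -> measurable_fun setT f -> (forall x, 0 <= f x) ->
  (forall B : set R, measurable B ->
     P (e @^-1` B) = (\int[lebesgue_measure]_(x in B) (f x)%:E)%E) ->
  (forall r : R, exists m M : R, 0 < m /\
     forall x, `|x| <= r -> m <= f x /\ f x <= M) ->
  measurable A -> A `<=` [set x | `|x| <= r] -> (0 < lebesgue_measure A)%E ->
  0 < m -> 0 < M ->
  (forall x, `|x| <= r -> `|mu x| <= Mmu) ->
  (forall x, `|x| <= r -> m <= sigma x <= M) ->
  exists2 p : R, 0 < p & forall x, `|x| <= r ->
    (p%:E <= P [set w | A (x + mu x + sigma x * e w)%R])%E.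
Proof.
move=> me mf f0 fE fb mA Ar A0 m0 M0 muM sM.
(* A noise value [v] leading from [x] into [A] satisfies [m * |v| <= |sigma x * v| <= 2 * r + Mmu],
   since start and landing point both lie in the ball of radius [r]. *)
have [c [Mf [mf0 fm]]] := fb ((2 * r + Mmu) / m).
have Afin : lebesgue_measure A \is a fin_num.
  rewrite ge0_fin_numE//; apply: (@le_lt_trans _ _
    (lebesgue_measure (`[- r, r]%classic : set R))).
    apply: le_measure; rewrite ?inE//.
    by move=> x /Ar /=; rewrite in_itv/= ler_norml.
  by rewrite lebesgue_measure_itv/=; case: ifP => _; rewrite ?ltry// -EFinD ltry.
have LA0 : 0 < fine (lebesgue_measure A) by rewrite fine_gt0// A0 -ge0_fin_numE.
exists (c * fine (lebesgue_measure A) / M).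
  by rewrite divr_gt0// mulr_gt0.
move=> x xr; have /andP[ms sMx] := sM x xr.
have s0 : 0 < sigma x by apply: lt_le_trans ms.
pose B := (fun v => x + mu x + sigma x * v) @^-1` A.
have mB : measurable B.
  rewrite -[X in measurable X]setTI.
  have : measurable_fun setT (fun v => x + mu x + sigma x * v).
    by apply: measurable_funD => //; exact: measurable_funM.
  exact.
have -> : P [set w | A (x + mu x + sigma x * e w)] = P (e @^-1` B) by [].
rewrite fE//.
apply: (@le_trans _ _ (\int[lebesgue_measure]_(v in B) (c%:E))%E).
  rewrite integral_cst//.
  have LA := lebesgue_measure_affine (x + mu x) s0 mA.
  have LAB : lebesgue_measure B =
      (fine (lebesgue_measure A) / sigma x)%:E.
    rewrite -/B in LA; rewrite mulrC EFinM fineK// LA muleA -EFinM.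
    by rewrite mulVf ?gt_eqF// mul1e.
  rewrite [X in (_ * X)%E]LAB -EFinM lee_fin mulrA ler_pM2l ?mulr_gt0//.
  by rewrite lef_pV2.
apply: ge0_le_integral => //.
- by move=> v _; rewrite lee_fin ltW.
- by apply/measurable_EFinP; apply: measurable_funTS.
move=> v Bv; rewrite lee_fin; apply: (proj1 (fm v _)).
rewrite ler_pdivlMr//.
have sv : sigma x * v = (x + mu x + sigma x * v) - x - mu x by ring.
apply: (@le_trans _ _ `|sigma x * v|).
  by rewrite normrM (gtr0_norm s0) mulrC ler_wpM2r.
rewrite sv; apply: le_trans (ler_normB _ _) _; apply: lerD; last exact: muM.
apply: le_trans (ler_normB _ _) _.
by have := Ar _ Bv; rewrite /= => ?; rewrite mulr2n mulrDl !mul1r; apply: lerD.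
Qed.

(** * Log wealth and the one-step drift of the Lyapunov function *)

(** The common shape of the upper bounds [Z] in the drift estimate; the linear term has mean zero
    and drops out. *)
Lemma integral_affine_abs_indic (d : measure_display) (T : measurableType d)
  (R : realType) (P : probability T R) (e : T -> R) (H : set T) (k s b D : R) :
  P.-integrable setT (fun w => (e w)%:E) ->
  (\int[P]_w (e w)%:E = 0)%E -> measurable H ->
  (\int[P]_w (k - s * e w + b * `|e w| - D * \1_H w)%:E =
   (k + b * fine (\int[P]_w `|e w|%:E) - D * fine (P H))%:E)%E.
Proof.
move=> ie e0 mH.
have ia : P.-integrable setT (fun w => `|e w|%:E) by exact: (integrable_abse ie).
have ik : P.-integrable setT (fun=> k%:E) by exact: finite_measure_integrable_cst.
have ise := integrableZl measurableT (- s) ie.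
have iba := integrableZl measurableT b ia.
have iH := integrableZl measurableT (- D) (integrable_indic P mH).
have i1 := integrableD measurableT ik ise.
have i2 := integrableD measurableT i1 iba.
transitivity (\int[P]_w (((k%:E + (- s)%:E * (e w)%:E) + b%:E * `|e w|%:E) +
    (- D)%:E * (\1_H w)%:E))%E.
  apply: eq_integral => w _; rewrite -!EFinM -!EFinD; congr EFin; ring.
rewrite integralD// integralD// integralD// !integralZl//; last exact: integrable_indic.
rewrite integral_cst// [X in (_ * X + _)%E]probability_setT e0 integral_indic//.
rewrite setIT mule1 mule0 adde0.
rewrite -[X in (b%:E * X)%E]fineK; last exact: integrable_fin_num.
rewrite -[X in ((- D)%:E * X)%E]fineK ?fin_num_measure//.
by rewrite -!EFinM -!EFinD mulNr.
Qed.

(** The state pairs the position with the accumulated [log (V_t / V0)], so that the two together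
    form one chain; [z.2] is the noise. *)
Definition log_step (R : realType) (mu sigma : R -> R) (z : R * R * R) : R * R :=
  let x := z.1.1 in let x' := x + mu x + sigma x * z.2 in
  (x', z.1.2 + \1_[set x : R | 0 < mu x] x * (x' - x)).

Definition lyapunov (R : realType) (beta D : R) (A : set R) (x : R) : R :=
  beta * (`|x| - D * \1_A x).

(** The wealth factor is [expR (x' - x)] where [mu x > 0] and 1 elsewhere, so its logarithm is the
    increment in [log_step]. *)
Lemma chain_log_step (d : measure_display) (T : measurableType d) (R : realType)
  (mu sigma : R -> R) (eps : nat -> T -> R) (X0 V0 : R) (t : nat) (w : T) :
  let z := chain (log_step mu sigma) (X0, 0) eps t w in
  Xproc mu sigma eps X0 t w = z.1 /\
  wealth V0 (pi_plus mu sigma eps X0) (Sproc mu sigma eps X0) t w =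
    V0 * expR z.2.
Proof.
elim: t => [|t [IHX IHV]] /=; first by rewrite expR0 mulr1.
split; first by rewrite IHX.
rewrite IHV /Sproc /= IHX /pi_plus /= IHX [X in _ = _ * X]expRD [RHS]mulrA; congr (_ * _).
set z := chain _ _ _ _ _; rewrite indicE; case: (_ \in _) => /=.
  by rewrite subrr add0r !mul1r expRB.
by rewrite subr0 !mul0r addr0 expR0.
Qed.

(** The true increment has no bound uniform in [x], as [mu] may be unbounded. Passing to an upper
    bound [Z] discards its large negative part and leaves a variable with explicit mean. *)
Lemma lyapunov_drift (d : measure_display) (T : measurableType d) (R : realType)
  (P : probability T R) (e : T -> R) (f mu sigma : R -> R) (M q r0 : R) :
  measurable_fun setT mu -> measurable_fun setT e ->
  measurable_fun setT f -> (forall x, 0 <= f x) ->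
  (forall B : set R, measurable B ->
     P (e @^-1` B) = (\int[lebesgue_measure]_(x in B) (f x)%:E)%E) ->
  (forall r : R, exists m M : R, 0 < m /\
     forall x, `|x| <= r -> m <= f x /\ f x <= M) ->
  (forall r : R, exists M : R, forall x, `|x| <= r -> `|mu x| <= M) ->
  (forall x, 0 < sigma x) ->
  (forall r : R, exists m : R, 0 < m /\ forall x, `|x| <= r -> m <= sigma x) ->
  (forall x, sigma x <= M) ->
  q < 1 -> (forall x, r0 < `|x| -> `|x + mu x| / `|x| <= q) ->
  P.-integrable setT (fun w => (e w)%:E) ->
  (\int[P]_w (e w)%:E = 0)%E ->
  (0 < lebesgue_measure [set x : R | (0 < mu x)%R])%E ->
  exists beta D C delta : R, exists A : set R,
    [/\ 0 <= beta, 0 <= D, 0 < delta, measurable A & forall x, exists Z : T -> R,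
      [/\ measurable_fun setT Z, forall w, `|Z w| <= C * (1 + `|e w|),
        (\int[P]_w (Z w)%:E <= (- delta)%:E)%E &
        forall w, let x' := x + mu x + sigma x * e w in
          lyapunov beta D A x' - lyapunov beta D A x
            - \1_[set x : R | 0 < mu x] x * (x' - x) <= Z w]].
Proof.
move=> mmu me mf f0 fE fb mub s0 sb sM q1 qr ie e0 mupos.
have [n n0 A0] := bounded_sublevel_gt0 mmu mupos.
set A := [set x | _] in A0.
have mA : measurable A.
  rewrite [X in measurable X](_ : _ =
      mu @^-1` `]n%:R^-1, +oo[ `&` Num.norm @^-1` `]-oo, n%:R]).
    by apply: measurableI; rewrite -[X in measurable X]setTI;
      [exact: mmu|exact: normr_measurable].
  by apply/seteqP; split=> x /=; rewrite !in_itv/= ?andbT.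
pose m1 := fine (\int[P]_w `|e w|%:E).
have m10 : 0 <= m1 by apply: fine_ge0; apply: integral_ge0 => w _; rewrite lee_fin.
have M0 : 0 < M by apply: lt_le_trans (s0 0) (sM 0).
have Mm0 : 0 <= M * m1 by rewrite mulr_ge0// ltW.
(* The ball must contain [A] (first term), reach the range of (A3) (second term), and make the
   inward pull [(1 - q) * r] exceed the mean noise [M * m1] by 1 (third term). *)
pose r := n%:R + `|r0| + (M * m1 + 1) / (1 - q).
have q10 : 0 < 1 - q by rewrite subr_gt0.
have fr0 : 0 <= (M * m1 + 1) / (1 - q).
  by rewrite divr_ge0 ?(ltW q10)// addr_ge0.
have nr : n%:R <= r by rewrite /r -addrA lerDl addr_ge0.
have rr0 : r0 <= r.
  by apply: le_trans (ler_norm _) _; rewrite /r addrAC lerDr addr_ge0.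
have rge0 : 0 <= r by apply: le_trans nr.
have rq : M * m1 + 1 <= (1 - q) * r.
  rewrite -ler_pdivrMl// mulrC /r lerDr addr_ge0//.
have [Mmu muM] := mub r; have [m [m0 sm]] := sb r.
have Mmu0 : 0 <= Mmu by apply: le_trans (normr_ge0 _) (muM 0 _); rewrite normr0.
have [p p0 pP] : exists2 p : R, 0 < p & forall x, `|x| <= r ->
    (p%:E <= P [set w | A (x + mu x + sigma x * e w)%R])%E.
  apply: (@affine_hitting_gt0 _ _ _ P e f mu sigma A r Mmu m M) => //.
    by move=> x [_ xn]; exact: le_trans xn nr.
  by move=> x xr; rewrite sm//=.
pose eta : R := n%:R^-1.
have eta0 : 0 < eta by rewrite invr_gt0 ltr0n.
(* The expected reward [D * p] for entering [A] exceeds by 1 the largest mean growth of [|x|] inside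
   the ball. *)
pose D := (Mmu + M * m1 + 1) / p.
have Dp : D * p = Mmu + M * m1 + 1 by rewrite divfK ?gt_eqF.
have D0 : 0 <= D by rewrite divr_ge0 ?(ltW p0)// !addr_ge0.
(* On [A] the Lyapunov term costs at most [beta * (Mmu + M * m1 + D)]; with another [beta] added
   this is half of the gain [eta]. *)
pose beta := eta / (2 * (Mmu + M * m1 + D + 1)).
have den0 : 0 < 2 * (Mmu + M * m1 + D + 1).
  by rewrite mulr_gt0// ltr_wpDl// !addr_ge0.
have beta0 : 0 < beta by rewrite divr_gt0.
have betaE : beta * (Mmu + M * m1 + D + 1) = eta / 2.
  by rewrite /beta; field; move: den0; rewrite pmulr_rgt0// => /gt_eqF ->.
clearbody beta D r.
(* The third witness [C] sums coefficient bounds for both forms of [Z]; [beta * D] counts twice,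
   once in [k] and once before the indicator of [H]. *)
exists beta, D, (Mmu + beta * Mmu + 2 * (beta * D) + beta * ((1 - q) * r) + M
  + beta * M).
(* The decay [delta] is [beta] itself: each of the three cases below has mean at most [- beta]. *)
exists beta, A; split=> //; try exact: ltW.
move=> x; set i : R := \1_[set x : R | 0 < mu x] x.
have i01 : 0 <= i <= 1 by rewrite /i indicE; case: (_ \in _); rewrite /= ?lexx ?ler01.
have imu : 0 <= i * mu x.
  rewrite /i indicE; case: (boolP (x \in _)) => [|_]; last by rewrite mul0r.
  by rewrite inE mul1r => /ltW.
have mX : measurable_fun setT (fun w => x + mu x + sigma x * e w).
  by apply: measurable_funD => //; exact: measurable_funM.
pose H := [set w | A (x + mu x + sigma x * e w)].
have mH : measurable H by rewrite -[X in measurable X]setTI; exact: mX.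
have mZ k s b D' : measurable_fun setT
    (fun w => k - s * e w + b * `|e w| - D' * \1_H w : R).
  apply: measurable_funB; last by apply: measurable_funM.
  apply: measurable_funD; last by apply: measurable_funM => //; exact: measurableT_comp.
  by apply: measurable_funB => //; exact: measurable_funM.
have HX w : \1_A (x + mu x + sigma x * e w) = \1_H w :> R.
  rewrite !indicE; congr ((_ : bool)%:R); apply/idP/idP; by rewrite !inE.
have H01 w : 0 <= (\1_H w : R) <= 1.
  by rewrite indicE; case: (_ \in _); rewrite /= ?lexx ?ler01.
have is0 : 0 <= i * sigma x <= M.
  have /andP[i0 i1] := i01; rewrite mulr_ge0//=; last exact: ltW.
  by apply: le_trans (sM x); rewrite ler_piMl// ltW.
have ZC k D' w : 0 <= D' -> `|k - (i * sigma x) * e w + beta * M * `|e w| - D' * \1_H w|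
    <= (`|k| + D' + M + beta * M) * (1 + `|e w|).
  move=> D'0; rewrite mulrDr mulr1.
  have hs : `|i * sigma x * e w| <= M * `|e w|.
    by have /andP[is00 isM] := is0; rewrite normrM (ger0_norm is00) ler_wpM2r.
  have hb : `|beta * M * `|e w| | = beta * M * `|e w|.
    by rewrite ger0_norm// !mulr_ge0 ?(ltW beta0) ?(ltW M0).
  have hH : `|D' * \1_H w| <= D'.
    have /andP[H0 H1] := H01 w.
    by rewrite normrM (ger0_norm D'0) ger0_norm// ler_piMr.
  have hk : 0 <= (`|k| + D') * `|e w| by rewrite mulr_ge0// addr_ge0.
  have t1 := ler_normB (k - i * sigma x * e w + beta * M * `|e w|) (D' * \1_H w).
  have t2 := ler_normD (k - i * sigma x * e w) (beta * M * `|e w|).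
  have t3 := ler_normB k (i * sigma x * e w).
  have M00 := ltW M0; have bM0 : 0 <= beta * M by rewrite mulr_ge0 ?(ltW beta0).
  lra.
have xsig w : `|sigma x * e w| <= M * `|e w|.
  by rewrite normrM (gtr0_norm (s0 x)) ler_wpM2r.
have [xr|rx] := leP `|x| r.
(* Inside the ball [|x'| <= |x| + |mu x| + M * |e|]. The last term of [k] is the reward lost by
   starting in [A]; the indicator of [H] restores it on landing there. *)
- pose k := - (i * mu x) + beta * `|mu x| + beta * D * \1_A x.
  exists (fun w => k - (i * sigma x) * e w + beta * M * `|e w| - (beta * D) * \1_H w).
  split=> //.
  + move=> w; apply: le_trans (ZC _ _ _ _) _.
      by rewrite mulr_ge0 ?(ltW beta0).
    rewrite ler_wpM2r ?addr_ge0//.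
    have hi : `|i * mu x| <= Mmu.
      have /andP[i0 i1] := i01; rewrite normrM (ger0_norm i0).
      by apply: le_trans (muM x xr); rewrite ler_piMl.
    have hk : `|k| <= Mmu + beta * Mmu + beta * D.
      have t1 := ler_normD (- (i * mu x) + beta * `|mu x|) (beta * D * \1_A x).
      have t2 := ler_normD (- (i * mu x)) (beta * `|mu x|).
      rewrite normrN in t2; rewrite -/k in t1.
      have t3 : `|beta * `|mu x| | <= beta * Mmu.
        by rewrite normrM normr_id (gtr0_norm beta0) ler_wpM2l ?(ltW beta0)// muM.
      have t4 : `|beta * D * \1_A x| <= beta * D.
        rewrite normrM ger0_norm ?mulr_ge0 ?(ltW beta0)//.
        rewrite ler_piMr ?mulr_ge0 ?(ltW beta0)//.
        by rewrite indicE ger0_norm//; case: (_ \in _); rewrite /= ?lexx ?ler01.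
      lra.
    have : 0 <= beta * ((1 - q) * r) by rewrite !mulr_ge0 ?(ltW beta0) ?(ltW q10).
    lra.
  + rewrite integral_affine_abs_indic// lee_fin -/m1.
    have pH : p <= fine (P H).
      by rewrite -lee_fin fineK ?fin_num_measure//; exact: pP.
    have bmu : beta * `|mu x| <= beta * Mmu by rewrite ler_wpM2l ?(ltW beta0)// muM.
    have bD : 0 <= beta * D by rewrite mulr_ge0 ?(ltW beta0).
    have bDp : beta * D * p <= beta * D * fine (P H) by rewrite ler_wpM2l.
    have bDpE : beta * D * p = beta * (Mmu + M * m1 + 1) by rewrite -mulrA Dp.
    (* Off [A] the chance [p] of entering [A] pays for the growth, by [bDpE]; on [A] the log gain
       [mu x > eta] pays, by [betaE]. *)
    rewrite /k; have [xA|xA] := boolP (x \in A); last first.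
      by rewrite indicE (negbTE xA) mulr0; lra.
    have mux : eta < mu x by move: xA; rewrite inE => -[].
    have -> : i = 1.
      by rewrite /i indicE mem_set//=; exact: lt_trans mux.
    rewrite indicE xA /=.
    have bDP0 : 0 <= beta * D * fine (P H) by rewrite mulr_ge0// (le_trans (ltW p0)).
    lra.
  + move=> w /=; rewrite /lyapunov HX.
    have xx : `|x + mu x + sigma x * e w| <= `|x| + `|mu x| + M * `|e w|.
      have t1 := ler_normD (x + mu x) (sigma x * e w).
      have t2 := ler_normD x (mu x); have := xsig w; lra.
    have bxx := ler_wpM2l (ltW beta0) xx.
    rewrite /k; lra.
- have jA : \1_A x = 0 :> R.
    rewrite indicE memNset// => -[_ xn]; move: rx; rewrite ltNge => /negP; apply.
    exact: le_trans xn nr.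
  have xq : `|x + mu x| <= q * `|x|.
    have r0x : r0 < `|x| by apply: le_lt_trans rx.
    have x0 : 0 < `|x| by apply: le_lt_trans rx.
    by rewrite -ler_pdivrMr// qr.
  (* Outside the ball the nonnegative gain [i * mu x] and the reward for landing in [A] are given
     up, and [(1 - q) * |x|] is lowered to [(1 - q) * r]. The coefficient 0 keeps the common
     shape. *)
  exists (fun w => - (beta * ((1 - q) * r)) - (i * sigma x) * e w
    + beta * M * `|e w| - 0 * \1_H w).
  split=> //.
  + move=> w; apply: le_trans (ZC _ _ _ _) _ => //.
    rewrite ler_wpM2r ?addr_ge0// normrN ger0_norm; last first.
      by rewrite !mulr_ge0 ?(ltW beta0) ?(ltW q10).
    have bMmu : 0 <= beta * Mmu by rewrite mulr_ge0 ?(ltW beta0).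
    have bD : 0 <= beta * D by rewrite mulr_ge0 ?(ltW beta0).
    lra.
  + rewrite integral_affine_abs_indic// lee_fin -/m1.
    have brq := ler_wpM2l (ltW beta0) rq.
    lra.
  + move=> w /=; rewrite /lyapunov HX jA.
    have xx : `|x + mu x + sigma x * e w| <= q * `|x| + M * `|e w|.
      have t1 := ler_normD (x + mu x) (sigma x * e w).
      have := xsig w; lra.
    have bxx := ler_wpM2l (ltW beta0) xx.
    have bqr : beta * ((1 - q) * r) <= beta * ((1 - q) * `|x|).
      by rewrite ler_wpM2l ?(ltW beta0)// ler_wpM2l ?(ltW q10)// ltW.
    have bDH : 0 <= beta * D * \1_H w.
      by have /andP[H0 _] := H01 w; rewrite !mulr_ge0 ?(ltW beta0).
    lra.
Qed.

Lemma measurable_log_step (R : realType) (mu sigma : R -> R) :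
  measurable_fun setT mu -> measurable_fun setT sigma ->
  measurable_fun setT (log_step mu sigma).
Proof.
move=> mmu msigma.
have m1 : measurable_fun setT (fun z : R * R * R => z.1.1).
  exact: measurableT_comp.
have mmu1 : measurable_fun setT (fun z : R * R * R => mu z.1.1).
  exact: (measurableT_comp mmu).
have mx' : measurable_fun setT
    (fun z : R * R * R => z.1.1 + mu z.1.1 + sigma z.1.1 * z.2).
  apply: measurable_funD; first exact: measurable_funD.
  by apply: measurable_funM => //; exact: (measurableT_comp msigma).
apply: measurable_fun_pair => //; apply: measurable_funD.
  exact: measurableT_comp.
apply: measurable_funM; last exact: measurable_funB.
apply: (measurableT_comp (g := fun z : R * R * R => z.1.1)) => //.
apply: measurable_indic; rewrite -[X in measurable X]setTI.
have -> : [set x | 0 < mu x] = mu @^-1` `]0, +oo[%classic.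
  by apply/seteqP; split=> x /=; rewrite in_itv/= andbT.
exact: mmu.
Qed.

(** * Exponential decay of the expected power utility *)

Theorem theoremp3p3 (d : measure_display) (T : measurableType d) (R : realType)
  (P : probability T R) (eps : nat -> T -> R) (mu sigma : R -> R)
  (X0 V0 : R) :
  (* measurability *)
  measurable_fun setT mu -> measurable_fun setT sigma ->
  (forall t, measurable_fun setT (eps t)) ->
  (* (eps_t)_{t >= 1} i.i.d. *)
  mutually_independent P eps [set t | (0 < t)%N] ->
  (forall t, (0 < t)%N -> forall B : set R, measurable B ->
     P (eps t @^-1` B) = P (eps 1%N @^-1` B)) ->
  (* (A1) *)
  (exists f : R -> R,
     measurable_fun setT f /\ (forall x, 0 <= f x) /\
     (forall B : set R, measurable B ->
        P (eps 1%N @^-1` B) = (\int[lebesgue_measure]_(x in B) (f x)%:E)%E) /\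
     (forall r : R, exists m M : R, 0 < m /\
        forall x, `|x| <= r -> m <= f x /\ f x <= M)) ->
  (* (A2) *)
  (forall r : R, exists M : R, forall x, `|x| <= r -> `|mu x| <= M) ->
  (forall x, 0 < sigma x) ->
  (forall r : R, exists m : R, 0 < m /\ forall x, `|x| <= r -> m <= sigma x) ->
  (exists M : R, forall x, sigma x <= M) ->
  (* (A3) : limsup_{|x| -> oo} |x + mu x| / |x| < 1 *)
  (exists q : R, q < 1 /\ exists r0 : R, forall x, r0 < `|x| ->
     `|x + mu x| / `|x| <= q) ->
  (* (A4) *)
  (exists kappa : R, 0 < kappa /\
     (\int[P]_w (expR (kappa * eps 1%N w ^+ 2))%:E < +oo)%E) ->
  P.-integrable setT (fun w => (eps 1%N w)%:E) ->
  (\int[P]_w (eps 1%N w)%:E = 0)%E ->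
  (* (RC+) *)
  (0 < lebesgue_measure [set x : R | (0 < mu x)%R])%E ->
  0 < V0 ->
  exists alpha0 : R, alpha0 < 0 /\
    forall alpha : R, alpha0 < alpha -> alpha < 0 ->
      exists K c : R, 0 < K /\ 0 < c /\
        exists t0 : nat, forall t : nat, (t0 <= t)%N ->
          (`| \int[P]_w (- ((wealth V0 (pi_plus mu sigma eps X0)
                               (Sproc mu sigma eps X0) t w) `^ alpha))%:E |
             <= (K * expR (- c * t%:R))%:E)%E.
Proof.
move=> mmu msigma meps ind idd [f [mf [f0 [fE fb]]]] mub s0 sb [M sM]
  [q [q1 [r0 qr]]] [kappa [k0 koo]] ie e0 mupos V00.
have [beta [D [C [delta [A [b0 D0 d0 mA drift]]]]]] := lyapunov_drift mmu
  (meps 1%N) mf f0 fE fb mub s0 sb sM q1 qr ie e0 mupos.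
pose g w := C * (1 + `|eps 1%N w|).
have iG : P.-integrable setT (fun w => (expR (3 * g w))%:E).
  have := integrable_expR_linear (3 * C) (3 * C) (meps 1%N) k0 koo.
  by apply: eq_integrable => // w _; rewrite /g mulrDr mulr1 mulrDr mulrA.
pose G := fine (\int[P]_w (expR (3 * g w))%:E).
have GE : (\int[P]_w (expR (3 * g w))%:E <= G%:E)%E.
  by rewrite fineK//; exact: integrable_fin_num.
have G0 : 0 <= G by apply: fine_ge0; apply: integral_ge0 => w _; rewrite lee_fin expR_ge0.
have G10 : 0 < 2 * (G + 1) by rewrite mulr_gt0// ltr_wpDl.
(* The bound 1 allows the quadratic expansion and the quotient yields [a * G <= delta / 2]; adding 1
   to [G] keeps the denominator positive. *)
pose a0 := Num.min 1 (delta / (2 * (G + 1))).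
have a00 : 0 < a0 by rewrite lt_min ltr01 divr_gt0.
exists (- a0); split; first by rewrite oppr_lt0.
move=> alpha alpha_a0 alpha0.
pose a := - alpha; have a_gt0 : 0 < a by rewrite oppr_gt0.
have : a < a0 by rewrite ltrNl.
rewrite lt_min => /andP[a1 ad].
have aG : a * G <= delta / 2.
  rewrite ltr_pdivlMr// in ad; rewrite ler_pdivlMr//; lra.
pose W (z : R * R) := expR (a * (lyapunov beta D A z.1 - z.2)).
have mlyap : measurable_fun setT (lyapunov beta D A).
  apply: measurable_funM => //; apply: measurable_funB.
    exact: normr_measurable.
  by apply: measurable_funM => //; exact: measurable_indic.
have mW : measurable_fun setT W.
  apply: measurableT_comp => //; apply: measurable_funM => //.
  by apply: measurable_funB => //; exact: measurableT_comp.
have mphi := measurable_log_step mmu msigma.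
pose rho := expR (- (a * delta / 2)).
have driftW y : (\int[P]_v (W (log_step mu sigma (y, eps 1%N v)))%:E
    <= (rho * W y)%:E)%E.
  have [Z [mZ ZC Zd YZ]] := drift y.1.
  have mE : measurable_fun setT (fun w => (expR (a * Z w))%:E).
    apply/measurable_EFinP; apply: measurableT_comp => //.
    exact: measurable_funM.
  (* One step multiplies [W] by the exponential of [a] times the Lyapunov increment minus the log
     gain, which [Z] bounds from above. *)
  apply: (@le_trans _ _ (\int[P]_v ((W y)%:E * (expR (a * Z v))%:E))%E).
    apply: ge0_le_integral => //.
    - by move=> v _; rewrite lee_fin expR_ge0.
    - apply/measurable_EFinP; apply: (measurableT_comp mW).
      apply: (measurableT_comp mphi); exact: measurable_fun_pair.
    - exact: emeasurable_funM.
    - move=> v _; rewrite -EFinM lee_fin -expRD ler_expR /= -mulrDr ler_pM2l//.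
      have := YZ v; rewrite /=; lra.
  rewrite ge0_integralZl//; last by move=> *; rewrite lee_fin expR_ge0.
  rewrite mulrC EFinM lee_wpmul2l ?lee_fin ?expR_ge0//.
  apply: (exp_moment_drift mZ ZC iG GE Zd) => //.
  by rewrite !ltW.
(* The factor [expR (a * (beta * D))] compensates the lower bound [- (beta * D)] of the Lyapunov
   function, [W (X0, 0)] is the initial value, and the rate is that of [rho]. *)
exists (V0 `^ alpha * expR (a * (beta * D)) * W (X0, 0)), (a * delta / 2).
split; first by rewrite !mulr_gt0 ?powR_gt0 ?expR_gt0.
split; first by rewrite divr_gt0 ?mulr_gt0.
exists 0%N => t _.
have mchain : measurable_fun setT (chain (log_step mu sigma) (X0, 0) eps t).
  exact: measurable_chain.
pose K0 := V0 `^ alpha * expR (a * (beta * D)).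
have K00 : 0 <= K0 by rewrite mulr_ge0 ?powR_ge0 ?expR_ge0.
pose V t w := wealth V0 (pi_plus mu sigma eps X0) (Sproc mu sigma eps X0) t w.
have VE w : V t w `^ alpha =
    V0 `^ alpha * expR (- (a * (chain (log_step mu sigma) (X0, 0) eps t w).2)).
  rewrite /V (proj2 (chain_log_step _ _ _ _ _ _ _)) powRM ?expR_ge0 ?(ltW V00)//.
  congr (_ * _); rewrite /powR gt_eqF ?expR_gt0// expRK /a.
  by congr expR; ring.
have mV : measurable_fun setT (fun w => V t w `^ alpha).
  under eq_fun do rewrite VE.
  apply: measurable_funM => //; apply: measurableT_comp => //.
  apply: measurableT_comp => //; apply: measurable_funM => //.
  exact: measurableT_comp.
rewrite (_ : (\int[P]_w _)%E = - (\int[P]_w (V t w `^ alpha)%:E))%E; last first.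
  rewrite -integral_ge0N//; last by move=> w _; rewrite lee_fin powR_ge0.
rewrite abseN gee0_abs; last by apply: integral_ge0 => w _; rewrite lee_fin powR_ge0.
(* As the Lyapunov function is at least [- (beta * D)], [K0 * W] dominates [V_t] to the power
   [alpha] pointwise. *)
apply: (@le_trans _ _ (\int[P]_w (K0%:E *
    (W (chain (log_step mu sigma) (X0, 0%R) eps t w))%:E))%E).
  apply: ge0_le_integral => //.
  - by move=> w _; rewrite lee_fin powR_ge0.
  - exact/measurable_EFinP.
  - apply: emeasurable_funM => //; apply/measurable_EFinP.
    exact: (measurableT_comp mW).
  - move=> w _; rewrite -EFinM lee_fin VE /K0 /W -mulrA ler_wpM2l ?powR_ge0//.
    rewrite -expRD ler_expR -mulrN -mulrDr ler_pM2l// /lyapunov.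
    set z := chain _ _ _ _ _.
    have iA : \1_A z.1 <= 1 :> R.
      by rewrite indicE; case: (_ \in _); rewrite /= ?lexx ?ler01.
    have h1 : 0 <= beta * `|z.1| by rewrite mulr_ge0.
    have h2 : beta * D * \1_A z.1 <= beta * D by rewrite ler_piMr ?mulr_ge0.
    lra.
rewrite ge0_integralZl//; last 2 first.
- by apply/measurable_EFinP; exact: (measurableT_comp mW).
- by move=> w _; rewrite lee_fin expR_ge0.
rewrite -[X in (_ <= X%:E)%E]mulrA -/K0 [X in (_ <= X)%E]EFinM.
apply: lee_wpmul2l; first by rewrite lee_fin.
apply: le_trans (chain_drift _ _ meps ind idd mphi mW _ _ driftW) _.
- by move=> y; exact: expR_ge0.
- exact: expR_ge0.
rewrite lee_fin mulrC /rho -expRM_natl.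
rewrite ler_wpM2l ?expR_ge0// ler_expR; lra.
Qed.
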